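(* Let $\mathcal{A}:f=0$ be a supersolvable line arrangement of $d$ lines in the complex projective plane $\mathbb{P}^2$, let $r=mdr(f)$, and assume $r\ge1$. If $p$ is a modular point of $\mathcal{A}$, then either $m_p(\mathcal{A})=r+1$, or $m_p(\mathcal{A})=d-r$. In particular, one has $$r=\min\{m_p(\mathcal{A})-1,\ d-m_p(\mathcal{A})\}.$$
   Context: A line arrangement $\mathcal{A}:f=0$ of $d$ lines is a finite set of $d$ distinct lines in $\mathbb{P}^2=\mathbb{P}^2(\mathbb{C})$, where $f\in S=\mathbb{C}[x,y,z]$ is the product of $d$ linear forms defining the lines. An intersection point of $\mathcal{A}$ is a point lying on at least two lines of $\mathcal{A}$; its multiplicity $m_p(\mathcal{A})$ is the number of lines of $\mathcal{A}$ through it. An intersection point $p$ is modular if for any other intersection point $q$ of $\mathcal{A}$ the line $\overline{pq}$ belongs to $\mathcal{A}$. $\mathcal{A}$ is supersolvable if it has a modular intersection point. $mdr(f)$ is the smallest integer $m\ge0$ such that there is a nontrivial relation $af_x+bf_y+cf_z=0$ among the partial derivatives of $f$ with $a,b,c\in S_m$ (homogeneous of degree $m$), not all zero. *)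

(* Defs.v *)
From mathcomp Require Import all_boot all_order all_algebra.
From mathcomp Require Import mpoly.

Set Implicit Arguments.
Unset Strict Implicit.
Unset Printing Implicit Defensive.

Import GRing.Theory.
Local Open Scope ring_scope.

(* Points and lines of the projective plane over K are the subspaces of K^3   *)
(* of dimension 1 and 2: incidence is inclusion, the line joining two         *)
(* distinct points is their sum, and equality is Leibniz equality.            *)

Definition is_point (K : fieldType) (p : {vspace 'rV[K]_3}) : bool :=
  \dim p == 1%N.

Definition is_line (K : fieldType) (H : {vspace 'rV[K]_3}) : bool :=
  \dim H == 2%N.

Definition line_arrangement (K : fieldType) (A : seq {vspace 'rV[K]_3}) :
    bool :=
  uniq A && all (@is_line K) A.

Definition multiplicity (K : fieldType) (A : seq {vspace 'rV[K]_3})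
    (p : {vspace 'rV[K]_3}) : nat :=
  count (fun H => (p <= H)%VS) A.

Definition intersection_point (K : fieldType) (A : seq {vspace 'rV[K]_3})
    (p : {vspace 'rV[K]_3}) : bool :=
  is_point p && (2 <= multiplicity A p)%N.

Definition modular_point (K : fieldType) (A : seq {vspace 'rV[K]_3})
    (p : {vspace 'rV[K]_3}) : Prop :=
  intersection_point A p /\
  forall q : {vspace 'rV[K]_3},
    intersection_point A q -> q <> p -> (p + q)%VS \in A.

Definition supersolvable (K : fieldType) (A : seq {vspace 'rV[K]_3}) : Prop :=
  exists p : {vspace 'rV[K]_3}, modular_point A p.

(* When H is a line, H != fullv, so such an l is nonzero.                     *)
Definition defining_form (K : fieldType) (H : {vspace 'rV[K]_3})
    (l : {mpoly K[3]}) : Prop :=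
  l \is 1.-homog /\ forall v : 'rV[K]_3, v \in H <-> l.@[v 0] = 0.

Definition defining_polynomial (K : fieldType) (A : seq {vspace 'rV[K]_3})
    (f : {mpoly K[3]}) : Prop :=
  exists l : {vspace 'rV[K]_3} -> {mpoly K[3]},
    (forall H, H \in A -> defining_form H (l H)) /\
    f = \prod_(H <- A) l H.

(* The zero polynomial is m.-homog for every m, so S_m is [m.-homog].         *)
Definition jacobian_syzygy (K : fieldType) (f : {mpoly K[3]}) (m : nat) :
    Prop :=
  exists a b c : {mpoly K[3]},
    [/\ [/\ a \is m.-homog, b \is m.-homog & c \is m.-homog],
        ~ [/\ a = 0, b = 0 & c = 0] &
        a * f^`M(inord 0%N) + b * f^`M(inord 1%N) + c * f^`M(inord 2%N) = 0].

Definition is_mdr (K : fieldType) (f : {mpoly K[3]}) (r : nat) : Prop :=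
  jacobian_syzygy f r /\ forall m : nat, jacobian_syzygy f m -> (r <= m)%N.

(* Main.v *)
From HB Require Import structures.
Require Import Defs.
From mathcomp Require Import all_boot all_order all_algebra.
From mathcomp Require Import ring zify.
From mathcomp Require Import reals complex mpoly.

(** Let p = <v> be modular of multiplicity m and write f = g h, where g is the
    product of the m lines through p and h that of the n = d - m others.

    Lower bound.  A syzygy a of degree r is a derivation killing f, so l divides
    a(l) for each line l.  If x, y are two lines through p, then g divides
    y a(x) - x a(y); when r + 1 < m this vanishes, so a agrees with a multiple
    w E of the Euler field on the forms vanishing at p, and a - w E = c D_v.
    Then h divides c, so c = 0 when r < n, and a f = d w f = 0 forces a = 0.

    Upper bounds.  Correcting h D_v by a multiple of E gives a syzygy of
    degree n.  In degree m - 1, fix a covector z with z(v) <> 0 and look for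
    theta = T + c D_v, with T(F) = det(z, grad g, grad F), such that each line l
    of h divides theta(l).  This is an interpolation problem for c, solved line
    by line as in Newton's scheme.  Adding a line l requires that, modulo l, the
    product of the earlier lines divide theta(l).  Modulo l an earlier line
    becomes, by modularity, proportional to a line mu of g = k mu.  The earlier
    lines proportional to mu modulo l all divide theta(l) - kappa l, where
    kappa = det(z, grad k, mu), which gives the divisibility by the power of mu
    that is needed; different mu are coprime. *)

Set Implicit Arguments.
Unset Strict Implicit.
Unset Printing Implicit Defensive.

Import GRing.Theory.

(** * Linear forms and vector fields with polynomial coefficients *)

Section Forms.
Local Open Scope ring_scope.
Variable K : fieldType.
Implicit Types (l m v w : 'rV[K]_3) (F G : {mpoly K[3]}).

Definition o0 : 'I_3 := inord 0.
Definition o1 : 'I_3 := inord 1.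
Definition o2 : 'I_3 := inord 2.

Lemma sum_I3 (V : nmodType) (E : 'I_3 -> V) : \sum_i E i = E o0 + E o1 + E o2.
Proof.
rewrite !big_ord_recl big_ord0 addr0 addrA.
by congr (E _ + E _ + E _); apply: val_inj; rewrite /= inordK.
Qed.

Lemma ord3P (i : 'I_3) : [\/ i = o0, i = o1 | i = o2].
Proof.
case: i => [[|[|[|//]]] hi]; [constructor 1|constructor 2|constructor 3];
  by apply: val_inj; rewrite /= inordK.
Qed.

Definition dot l v : K := \sum_i l 0 i * v 0 i.

(** A triple [a] stands for the vector field with these coefficients, and [pairing l a] is its value
    on the linear form of covector [l] (see [der_lin]). The Euler field has the coordinates as
    coefficients and fixes linear forms, whence [lin]. *)
Definition pairing l (a : 'I_3 -> {mpoly K[3]}) : {mpoly K[3]} :=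
  \sum_i (l 0 i)%:MP * a i.

Definition lin l : {mpoly K[3]} := pairing l (fun i => 'X_i).

Definition const_field v : 'I_3 -> {mpoly K[3]} := fun i => (v 0 i)%:MP.

Definition der (a : 'I_3 -> {mpoly K[3]}) F : {mpoly K[3]} :=
  \sum_i a i * F^`M(i).

Lemma dotC l v : dot l v = dot v l.
Proof. by apply: eq_bigr => i _; rewrite mulrC. Qed.

Lemma dotB l m v : dot (l - m) v = dot l v - dot m v.
Proof. by rewrite /dot -sumrB; apply: eq_bigr => i _; rewrite !mxE mulrBl. Qed.

Lemma dotD l m v : dot (l + m) v = dot l v + dot m v.
Proof. by rewrite /dot -big_split; apply: eq_bigr => i _; rewrite !mxE mulrDl. Qed.

Lemma dotZ t l v : dot (t *: l) v = t * dot l v.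
Proof. by rewrite /dot mulr_sumr; apply: eq_bigr => i _; rewrite !mxE mulrA. Qed.

Lemma pairingD l m a : pairing (l + m) a = pairing l a + pairing m a.
Proof.
by rewrite /pairing -big_split; apply: eq_bigr => i _; rewrite !mxE mpolyCD mulrDl.
Qed.

Lemma pairingZ t l a : pairing (t *: l) a = t%:MP * pairing l a.
Proof.
by rewrite /pairing mulr_sumr; apply: eq_bigr => i _; rewrite !mxE mpolyCM mulrA.
Qed.

Lemma pairingB l m a : pairing (l - m) a = pairing l a - pairing m a.
Proof. by rewrite pairingD -scaleN1r pairingZ mpolyCN mpolyC1 mulN1r. Qed.

Lemma pairing_comb l F a G b :
  pairing l (fun i => F * a i + G * b i) = F * pairing l a + G * pairing l b.
Proof.
by rewrite /pairing !mulr_sumr -big_split; apply: eq_bigr => i _ /=; ring.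
Qed.

Lemma pairing_const l v : pairing l (const_field v) = (dot l v)%:MP.
Proof.
by rewrite /pairing /dot raddf_sum; apply: eq_bigr => i _; rewrite /= mpolyCM.
Qed.

Lemma pairing_delta i a : pairing (delta_mx 0 i) a = a i.
Proof.
rewrite /pairing (bigD1 i) //= big1 ?addr0; first by rewrite !mxE !eqxx mpolyC1 mul1r.
by move=> j ji; rewrite !mxE (negbTE ji) andbF mpolyC0 mul0r.
Qed.

Lemma der_comb F a G b H :
  der (fun i => F * a i + G * b i) H = F * der a H + G * der b H.
Proof.
by rewrite /der !mulr_sumr -big_split; apply: eq_bigr => i _ /=; ring.
Qed.

Lemma derM a F G : der a (F * G) = der a F * G + F * der a G.
Proof.
rewrite /der mulr_suml mulr_sumr -big_split; apply: eq_bigr => i _ /=.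
by rewrite mderivM; ring.
Qed.

Lemma derC a c : der a c%:MP = 0.
Proof. by rewrite /der big1 // => i _; rewrite mderivC mulr0. Qed.

Lemma der1 a : der a 1 = 0.
Proof. by rewrite -mpolyC1 derC. Qed.

Lemma mderivXU (i j : 'I_3) : ('X_j : {mpoly K[3]})^`M(i) = (i == j)%:R.
Proof.
rewrite mderivX mnmE eq_sym; case: eqVneq => [->|]; last by rewrite scale0r.
have -> : (U_(j) - U_(j) = 0)%MM by apply/mnmP => k; rewrite mnmBE subnn mnm0E.
by rewrite mpolyX0 scale1r.
Qed.

Lemma mderiv_lin l i : (lin l)^`M(i) = (l 0 i)%:MP.
Proof.
rewrite /lin /pairing raddf_sum (bigD1 i) //= big1 => [|j ji].
  by rewrite addr0 mderiv_mulC mderivXU eqxx mulr1.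
by rewrite mderiv_mulC mderivXU eq_sym (negbTE ji) mulr0.
Qed.

Lemma der_lin a l : der a (lin l) = pairing l a.
Proof. by apply: eq_bigr => i _; rewrite mderiv_lin mulrC. Qed.

Lemma der_prod (T : eqType) a (s : seq T) (F q : T -> {mpoly K[3]}) :
  (forall t, t \in s -> der a (F t) = q t * F t) ->
  der a (\prod_(t <- s) F t) = (\sum_(t <- s) q t) * \prod_(t <- s) F t.
Proof.
elim: s => [|t s IH] h; first by rewrite !big_nil der1 mul0r.
rewrite !big_cons derM h ?mem_head // IH => [|u us]; last by rewrite h ?inE ?us ?orbT.
ring.
Qed.

(** Euler's identity: each factor has logarithmic derivative 1 along the Euler field, and these add
    up. *)
Lemma euler_prod (s : seq 'rV[K]_3) :
  der (fun i => 'X_i) (\prod_(l <- s) lin l) = (size s)%:R * \prod_(l <- s) lin l.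
Proof.
rewrite (der_prod (q := fun=> 1)) => [|l _]; last by rewrite der_lin mul1r.
by rewrite big_const_seq count_predT iter_addr_0.
Qed.

Lemma lin_homog l : lin l \is 1.-homog.
Proof.
apply: rpred_sum => i _; rewrite mul_mpolyC; apply: dhomogZ.
by rewrite dhomogX /= mdeg1.
Qed.

Lemma lin_eq0_inv l : lin l = 0 -> l = 0.
Proof.
move=> h; apply/rowP => i; rewrite mxE.
by have := mderiv_lin l i; rewrite h raddf0 => /esym/eqP; rewrite mpolyC_eq0 => /eqP.
Qed.

Definition coefs F : 'rV[K]_3 := \row_i F@_(U_(i)).

Lemma lin_coefs F : F \is 1.-homog -> F = lin (coefs F).
Proof.
move=> hF; apply/mpolyP => m.
rewrite /lin /pairing raddf_sum /=.
have [/eqP/eqP/mdeg1P [i /eqP ->]|hm] := boolP (mdeg m == 1).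
  rewrite (bigD1 i) //= big1 => [|j ji].
    by rewrite addr0 mcoeffCM mcoeffX eqxx mulr1 mxE.
  by rewrite mcoeffCM mcoeffX eq_mnm1 (negbTE ji) mulr0.
rewrite (dhomog_nemf_coeff hF hm) big1 // => i _.
rewrite mcoeffCM mcoeffX; case: eqP => [e|]; last by rewrite mulr0.
by rewrite -e mdeg1 in hm.
Qed.

Lemma meval_lin l v : (lin l).@[v 0] = dot l v.
Proof.
by rewrite /lin /pairing /dot raddf_sum; apply: eq_bigr => i _ /=;
  rewrite mevalM mevalC mevalXU.
Qed.

Lemma dot_delta l i : dot l (delta_mx 0 i) = l 0 i.
Proof.
rewrite /dot (bigD1 i) //= big1 => [|j ji]; first by rewrite !mxE !eqxx mulr1 addr0.
by rewrite !mxE (negbTE ji) andbF mulr0.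
Qed.

Lemma dot_neq0 l : l != 0 -> exists w, dot l w != 0.
Proof. by move=> /rV0Pn [i li]; exists (delta_mx 0 i); rewrite dot_delta. Qed.

(** * Divisibility by linear forms *)

Definition dvd F G : Prop := exists Q, G = Q * F.

Lemma dvd0 F : dvd F 0. Proof. by exists 0; rewrite mul0r. Qed.
Lemma dvdD F G H : dvd F G -> dvd F H -> dvd F (G + H).
Proof. by move=> [q ->] [r ->]; exists (q + r); rewrite mulrDl. Qed.
Lemma dvdB F G H : dvd F G -> dvd F H -> dvd F (G - H).
Proof. by move=> [q ->] [r ->]; exists (q - r); rewrite mulrBl. Qed.
Lemma dvd_mull F G H : dvd F G -> dvd F (H * G).
Proof. by move=> [q ->]; exists (H * q); rewrite mulrA. Qed.
Lemma dvd_mulr F G H : dvd F G -> dvd F (G * H).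
Proof. by rewrite mulrC; apply: dvd_mull. Qed.
Lemma dvd_refl F : dvd F F. Proof. by exists 1; rewrite mul1r. Qed.
Lemma dvd_trans F G H : dvd F G -> dvd G H -> dvd F H.
Proof. by move=> FG [q ->]; apply: dvd_mull. Qed.
Lemma dvd_scal F G c : c != 0 -> dvd F (c%:MP * G) -> dvd F G.
Proof.
move=> c0 /(dvd_mull (c^-1)%:MP); by rewrite mulrA -mpolyCM mulVf // mpolyC1 mul1r.
Qed.

(** Projection onto the plane [lin l = 0] along [w]; its kernel is generated by
    [lin l], which turns divisibility by a linear form into an equation. *)
Definition proj l w : {mpoly K[3]} -> {mpoly K[3]} :=
  comp_mpoly [tuple 'X_i - (w 0 i / dot l w)%:MP * lin l | i < 3].

HB.instance Definition _ l w := GRing.RMorphism.on (proj l w).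

Lemma projX l w i : proj l w 'X_i = 'X_i - (w 0 i / dot l w)%:MP * lin l.
Proof. by rewrite /proj comp_mpolyXU -tnth_nth tnth_mktuple. Qed.

Lemma proj_const l w c : proj l w c%:MP = c%:MP.
Proof. exact: comp_mpolyC. Qed.

Lemma proj_lin l w m :
  proj l w (lin m) = lin (m - (dot m w / dot l w) *: l).
Proof.
rewrite /lin pairingB pairingZ -/(lin l) /pairing rmorph_sum /=.
under eq_bigr do rewrite rmorphM /= proj_const projX mulrBr.
rewrite sumrB; congr (_ - _); rewrite /dot mulr_suml raddf_sum mulr_suml /=.
by apply: eq_bigr => i _; rewrite mulrA -mpolyCM mulrA.
Qed.

Lemma proj_self l w : dot l w != 0 -> proj l w (lin l) = 0.
Proof.
move=> h; rewrite proj_lin divff // scale1r subrr /lin /pairing.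
by rewrite big1 // => i _; rewrite mxE mpolyC0 mul0r.
Qed.

Lemma dvd_proj l w F : dvd (lin l) (F - proj l w F).
Proof.
(* The polynomials congruent to their projection include constants and variables and are closed
   under sums and products. *)
pose P F := dvd (lin l) (F - proj l w F); rewrite -/(P F).
have PM G H : P G -> P H -> P (G * H).
  rewrite /P rmorphM /= => hG hH.
  have -> : G * H - proj l w G * proj l w H =
    H * (G - proj l w G) + proj l w G * (H - proj l w H) by ring.
  by apply: dvdD; apply: dvd_mull.
have PC c : P c%:MP by rewrite /P proj_const subrr; apply: dvd0.
elim/mpolyind: F => [|c m F _ _ IH]; first by rewrite -mpolyC0.
rewrite /P raddfD /= opprD addrACA; apply: dvdD; last exact: IH.
rewrite -mul_mpolyC; apply: (PM) => //; rewrite mpolyXE_id.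
apply: (big_ind P) => [|//|i _]; first by rewrite -mpolyC1.
elim: (m i) => [|k IHk]; first by rewrite expr0 -mpolyC1.
rewrite exprS; apply: PM => //; rewrite /P projX.
by rewrite opprB addrC subrK; apply: dvd_mull; apply: dvd_refl.
Qed.

Lemma dvd_lin_proj l w F : dot l w != 0 -> dvd (lin l) F <-> proj l w F = 0.
Proof.
move=> h; split => [[q ->]|h0]; first by rewrite rmorphM /= proj_self // mulr0.
by have := dvd_proj l w F; rewrite h0 subr0.
Qed.

(** The multiples of [lin l] are the kernel of a ring morphism into a domain, hence a prime
    ideal. *)
Lemma lin_prime l F G : l != 0 ->
  dvd (lin l) (F * G) -> dvd (lin l) F \/ dvd (lin l) G.
Proof.
move=> /dot_neq0 [w lw]; rewrite !(dvd_lin_proj _ lw) rmorphM => /eqP.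
by rewrite mulf_eq0 => /orP [] /eqP ->; [left|right].
Qed.

Lemma dvd_lin_lin l m : l != 0 -> dvd (lin l) (lin m) -> (m <= l)%MS.
Proof.
move=> /dot_neq0 [w lw]; rewrite (dvd_lin_proj _ lw) proj_lin => /lin_eq0_inv/eqP.
by rewrite subr_eq0 => /eqP ->; apply: scalemx_sub.
Qed.

Lemma lin_eq0 l : (lin l == 0) = (l == 0).
Proof.
apply/eqP/eqP => [/lin_eq0_inv //|->]; rewrite /lin /pairing.
by rewrite big1 // => i _; rewrite mxE mpolyC0 mul0r.
Qed.

Lemma prod_lin_neq0 s : 0 \notin s -> \prod_(l <- s) lin l != 0.
Proof.
move=> h; rewrite big_seq prodf_seq_neq0; apply/allP => l ls; rewrite ls /= lin_eq0.
by apply: contraNneq h => <-.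
Qed.

Lemma dvd_lin_prodl l (s : seq 'rV[K]_3) F : l != 0 ->
  (forall m, m \in s -> ~~ (m <= l)%MS) ->
  dvd (lin l) (F * \prod_(m <- s) lin m) -> dvd (lin l) F.
Proof.
move=> l0; elim: s F => [|m s IH] F hs; first by rewrite big_nil mulr1.
rewrite big_cons mulrA => /(IH _ _) []// => [k ks|q].
  by apply: hs; rewrite inE ks orbT.
move=> e; have : dvd (lin l) (F * lin m) by exists q.
case/(lin_prime l0) => // /(dvd_lin_lin l0) ml.
by move: (hs m (mem_head _ _)); rewrite ml.
Qed.

(** The factors of [s1] are peeled off one at a time: each is prime to the product over [s2], so it
    divides [F] and can be cancelled. Forms within [s1] may be proportional to each other. *)
Lemma dvd_prod_prodl (s1 s2 : seq 'rV[K]_3) F : 0 \notin s1 ->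
  (forall l m, l \in s1 -> m \in s2 -> ~~ (m <= l)%MS) ->
  dvd (\prod_(l <- s1) lin l) (F * \prod_(m <- s2) lin m) ->
  dvd (\prod_(l <- s1) lin l) F.
Proof.
elim: s1 F => [|l s1 IH] F; first by exists F; rewrite big_nil mulr1.
rewrite inE negb_or eq_sym => /andP [l0 s10] h; rewrite !big_cons => -[q e].
have [k ek] : dvd (lin l) F.
  apply: (@dvd_lin_prodl _ s2) => // [m ms|]; first by apply: h; rewrite ?mem_head.
  by rewrite e mulrA mulrAC; apply: dvd_mull; apply: dvd_refl.
suff [k' e'] : dvd (\prod_(i <- s1) lin i) k.
  by exists k'; rewrite ek e'; ring.
apply: IH => // [a b a1 b2|]; first by apply: h => //; rewrite inE a1 orbT.
exists q; apply: (@mulIf _ (lin l)); first by rewrite lin_eq0.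
by rewrite mulrAC -ek e; ring.
Qed.

End Forms.

(** * Divisibility by products of linear forms *)

Section Divisibility.
Local Open Scope ring_scope.
Variable K : fieldType.
Implicit Types (l m v w : 'rV[K]_3) (F G : {mpoly K[3]}) (s : seq 'rV[K]_3).

Lemma row_sub_sym l m : l != 0 -> (l <= m)%MS -> (m <= l)%MS.
Proof.
move=> l0 /sub_rVP [t e]; apply/sub_rVP; exists t^-1.
rewrite e scalerA mulVf ?scale1r //; apply: contraNneq l0 => t0.
by rewrite e t0 scale0r.
Qed.

Definition indep l m : bool := ~~ (l <= m)%MS && ~~ (m <= l)%MS.

Lemma prod_dvd_indep s F : 0 \notin s -> pairwise indep s ->
  (forall l, l \in s -> dvd (lin l) F) -> dvd (\prod_(l <- s) lin l) F.
Proof.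
elim: s => [|l s IH]; first by exists F; rewrite big_nil mulr1.
rewrite inE negb_or eq_sym => /andP [l0 s0] /= /andP [/allP hl hs] h.
have [q e] : dvd (\prod_(l <- s) lin l) F.
  by apply: IH => // m ms; apply: h; rewrite inE ms orbT.
have [k ek] : dvd (lin l) q.
  apply: (@dvd_lin_prodl _ _ s) => // [m ms|]; last by rewrite -e; apply: h; rewrite mem_head.
  by have /andP [] := hl _ ms.
by exists k; rewrite big_cons e ek mulrA.
Qed.

(** Proportional forms may repeat in [s], so each proportionality class has to
    be assumed to divide [F] with its multiplicity. *)
Lemma prod_dvd_clusters s F : 0 \notin s ->
  (forall l, l \in s -> dvd (\prod_(m <- s | (m <= l)%MS) lin m) F) ->
  dvd (\prod_(l <- s) lin l) F.
Proof.
have [n] := ubnP (size s); elim: n s => // n IH [|l s] /= hn s0 h.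
  by exists F; rewrite big_nil mulr1.
(* [s1] is the proportionality class of [l]. The shorter list [s2] is handled by induction, and
   since the two products are coprime, the one over [s1] divides the quotient. *)
pose s1 := [seq m <- l :: s | (m <= l)%MS].
pose s2 := [seq m <- l :: s | ~~ (m <= l)%MS].
have nz m : m \in l :: s -> m != 0 by move=> ms; apply: contraNneq s0 => <-.
have [q e] : dvd (\prod_(m <- s2) lin m) F.
  apply: IH => [||m].
  - have : size s1 + size s2 = size (l :: s).
      by rewrite !size_filter -[RHS](count_predC (fun m => (m <= l)%MS)).
    by rewrite {1}/s1 /= submx_refl /=; lia.
  - by rewrite mem_filter (negbTE s0) andbF.
  (* No form of [s1] is proportional to [m], so passing to [s2] leaves the class of [m]
     unchanged. *)
  rewrite mem_filter => /andP [ml ms]; have := h _ ms; congr (dvd _ F).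
  rewrite big_filter_cond big_seq_cond [RHS]big_seq_cond; apply: eq_bigl => x.
  case: (boolP (x \in _)) => //= xs; case: (boolP (x <= m)%MS) => xm; last by rewrite andbF.
  rewrite andbT; apply/esym; apply: contraNN ml; apply: submx_trans.
  by apply: row_sub_sym => //; apply: nz.
have [k ek] : dvd (\prod_(m <- s1) lin m) q.
  apply: (@dvd_prod_prodl _ s1 s2).
  - by rewrite mem_filter (negbTE s0) andbF.
  - move=> a b; rewrite !mem_filter => /andP [al _] /andP [bl _].
    by apply: contraNN bl => /submx_trans; apply.
  rewrite -e big_filter; apply: h; exact: mem_head.
exists k; rewrite e ek -mulrA; congr (_ * _).
by rewrite [RHS](bigID (fun m => (m <= l)%MS)) /= !big_filter.
Qed.

(** * Homogeneous components *)

Local Notation hcomp := (pihomog [measure of mdeg]).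

(** Multiplying by a form of degree [j] shifts the grading by [j]; the test guards against truncated
    subtraction. *)
Lemma hcompM i j F G : G \is j.-homog ->
  hcomp i (F * G) = if (j <= i)%N then hcomp (i - j) F * G else 0.
Proof.
move=> hG; pose N := maxn (msize F) i.+1.
have hN : (msize F <= N)%N by exact: leq_maxl.
rewrite {1}(pihomog_partitionE (mf := [measure of mdeg]) hN) mulr_suml raddf_sum /=.
have hd (d : 'I_N) : hcomp d F * G \is (d + j).-homog by apply: dhomogM (pihomogP _ _ _) hG.
case: leqP => ji; last first.
  by apply: big1 => d _; apply: pihomog_ne0 (hd d); apply/eqP; lia.
have iN : (i - j < N)%N by rewrite (leq_ltn_trans (leq_subr _ _)) // leq_maxr.
rewrite (bigD1 (Ordinal iN)) //= big1 => [|d /negP di]; last first.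
  apply: pihomog_ne0 (hd d); apply/eqP => e; apply: di; apply/eqP/val_inj => /=; lia.
by rewrite addr0 pihomog_dE //; have := hd (Ordinal iN); rewrite /= subnK.
Qed.

(** The quotient need not be homogeneous: a multiple of [G] has no component of degree below [j]. *)
Lemma homog_dvd_eq0 i j F G : F \is i.-homog -> G \is j.-homog -> (i < j)%N ->
  dvd G F -> F = 0.
Proof.
move=> hF hG ij [q e]; rewrite -(pihomog_dE hF) e (hcompM _ _ hG).
by rewrite leqNgt ij.
Qed.

Lemma homog_quotient i j F G : F \is (i + j).-homog -> G \is j.-homog -> G != 0 ->
  forall Q, F = Q * G -> Q \is i.-homog.
Proof.
move=> hF hG G0 Q e.
have := pihomog_dE hF; rewrite {1}e (hcompM _ _ hG) leq_addl addnK e.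
by move/(mulIf G0) => <-; apply: pihomogP.
Qed.

Lemma prod_lin_homog s : \prod_(l <- s) lin l \is (size s).-homog.
Proof.
elim: s => [|l s IH]; first by rewrite big_nil dhomog1.
by rewrite big_cons; apply: (dhomogM (lin_homog l) IH).
Qed.

(** For [k = 0] the truncated predecessor is harmless: the derivative is zero, which is homogeneous
    of every degree. *)
Lemma mderiv_homog k F i : F \is k.-homog -> F^`M(i) \is (k.-1).-homog.
Proof.
move=> hF; rewrite /mderiv big_seq; apply: rpred_sum => m ms.
have [mi|mi] := eqVneq (m i) 0%N; first by rewrite mi mul0r scale0r rpred0.
apply: dhomogZ; rewrite dhomogX; apply/eqP.
have <- := dhomog_mf hF ms.
have e : (m - U_(i) + U_(i))%MM = m by rewrite submK // lep1mP.
by rewrite -{2}e /= mdegD mdeg1 addn1.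
Qed.

(** * Cross products and the field T *)

Definition cross_prod (a b : 'I_3 -> {mpoly K[3]}) (i : 'I_3) : {mpoly K[3]} :=
  if i == o0 then a o1 * b o2 - a o2 * b o1
  else if i == o1 then a o2 * b o0 - a o0 * b o2
  else a o0 * b o1 - a o1 * b o0.

Lemma cross_prodE a b : [/\ cross_prod a b o0 = a o1 * b o2 - a o2 * b o1,
  cross_prod a b o1 = a o2 * b o0 - a o0 * b o2 & cross_prod a b o2 = a o0 * b o1 - a o1 * b o0].
Proof.
by split; rewrite /cross_prod -!val_eqE /= !inordK.
Qed.

Definition grad F (i : 'I_3) : {mpoly K[3]} := F^`M(i).

(** As a derivation this sends G to det(z, grad F, grad G), so it kills both [F] and the linear form
    of [z]. *)
Definition tangent z F := cross_prod (const_field z) (grad F).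

Lemma der_tangent z F : der (tangent z F) F = 0.
Proof.
rewrite /der sum_I3 /tangent; have [-> -> ->] := cross_prodE (const_field z) (grad F).
by rewrite /grad; ring.
Qed.

Lemma pairing_tangent_self z F : pairing z (tangent z F) = 0.
Proof.
rewrite /pairing sum_I3 /tangent; have [-> -> ->] := cross_prodE (const_field z) (grad F).
by rewrite /const_field; ring.
Qed.

(** The gradient of the product is [lin m] times that of [F] plus a multiple of [m], and det(z, m,
    m) = 0. *)
Lemma pairing_tangentM z m F : pairing m (tangent z (F * lin m)) = pairing m (tangent z F) * lin m.
Proof.
rewrite /pairing !sum_I3 /tangent; have [-> -> ->] := cross_prodE (const_field z) (grad F).
have [-> -> ->] := cross_prodE (const_field z) (grad (F * lin m)).
by rewrite /grad /const_field !mderivM !mderiv_lin; ring.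
Qed.

Lemma tangent_eq0 z v F : dot z v != 0 -> der (const_field v) F = 0 ->
  (forall i, tangent z F i = 0) -> forall i, F^`M(i) = 0.
Proof.
move=> zv hv h i.
(* Expand v x (z x grad F) = (v . grad F) z - (v . z) grad F. *)
suff: (dot z v)%:MP * F^`M(i) = 0.
  by move/eqP; rewrite mulf_eq0 mpolyC_eq0 (negbTE zv) => /eqP.
have [e0 e1 e2] := cross_prodE (const_field z) (grad F).
move: hv (h o0) (h o1) (h o2); rewrite /tangent e0 e1 e2 /der /dot !sum_I3 /const_field /grad.
rewrite !mpolyCD !mpolyCM => hv h0 h1 h2.
case: (ord3P i) => ->.
- transitivity ((z 0 o0)%:MP * ((v 0 o0)%:MP * F^`M(o0) + (v 0 o1)%:MP * F^`M(o1) +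
    (v 0 o2)%:MP * F^`M(o2))
    + (v 0 o2)%:MP * ((z 0 o2)%:MP * F^`M(o0) - (z 0 o0)%:MP * F^`M(o2))
    - (v 0 o1)%:MP * ((z 0 o0)%:MP * F^`M(o1) - (z 0 o1)%:MP * F^`M(o0))); first by ring.
  by rewrite hv h1 h2 !mulr0 addr0 subr0.
- transitivity ((z 0 o1)%:MP * ((v 0 o0)%:MP * F^`M(o0) + (v 0 o1)%:MP * F^`M(o1) +
    (v 0 o2)%:MP * F^`M(o2))
    + (v 0 o0)%:MP * ((z 0 o0)%:MP * F^`M(o1) - (z 0 o1)%:MP * F^`M(o0))
    - (v 0 o2)%:MP * ((z 0 o1)%:MP * F^`M(o2) - (z 0 o2)%:MP * F^`M(o1))); first by ring.
  by rewrite hv h0 h2 !mulr0 addr0 subr0.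
- transitivity ((z 0 o2)%:MP * ((v 0 o0)%:MP * F^`M(o0) + (v 0 o1)%:MP * F^`M(o1) +
    (v 0 o2)%:MP * F^`M(o2))
    + (v 0 o1)%:MP * ((z 0 o1)%:MP * F^`M(o2) - (z 0 o2)%:MP * F^`M(o1))
    - (v 0 o0)%:MP * ((z 0 o2)%:MP * F^`M(o0) - (z 0 o0)%:MP * F^`M(o2))); first by ring.
  by rewrite hv h0 h1 !mulr0 addr0 subr0.
Qed.

End Divisibility.

(** * Interpolation of the coefficient of D_v, line by line *)

Section Newton.
Local Open Scope ring_scope.
Variable K : fieldType.
Implicit Types (l m v w z : 'rV[K]_3) (F G g : {mpoly K[3]}) (s : seq 'rV[K]_3).

(** The line joining <v> to the intersection of the lines [l] and [m]; junk when
    [dot l v = 0]. *)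
Definition residue v l m : 'rV[K]_3 := m - (dot m v / dot l v) *: l.

Lemma dvd_prod_mem s l : l \in s -> dvd (lin l) (\prod_(m <- s) lin m).
Proof.
by move=> ls; rewrite (big_rem l ls) /=; apply: dvd_mulr; apply: dvd_refl.
Qed.

(** This treats the earlier lines that become proportional to mu modulo [l]. For such a line m = a l
    + t mu with mu(v) = 0, and theta(mu) = kappa mu gives theta(m) - kappa m = a (theta(l) - kappa
    l). Thus all these independent forms divide the same polynomial theta(l) - kappa l, and so does
    their product. *)
Lemma cluster_dvd v z g s l m0 c : dot l v != 0 ->
  {in s, forall m, dot m v != 0} -> pairwise (@indep K) s -> 0 \notin s ->
  dvd (lin (residue v l m0)) g ->
  {in s, forall m, dvd (lin m) (pairing m (tangent z g) + c * (dot m v)%:MP)} ->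
  dvd (\prod_(m <- [seq residue v l m | m <- s] | (m <= residue v l m0)%MS) lin m)
      (proj l v (pairing l (tangent z g) + c * (dot l v)%:MP)).
Proof.
move=> lv sv ps s0 [k eg] hc; set mu := residue v l m0 in eg *.
pose G := pairing l (tangent z g) + c * (dot l v)%:MP; rewrite -/G.
pose kappa := pairing mu (tangent z k).
pose C := [seq m <- s | (residue v l m <= mu)%MS].
have [q e] : dvd (\prod_(m <- C) lin m) (G - kappa * lin l).
  apply: prod_dvd_indep; rewrite ?mem_filter ?(negbTE s0) ?andbF //.
    exact: pairwise_filter.
  move=> m; rewrite /C mem_filter => /andP [/sub_rVP [t et] ms].
  pose a := dot m v / dot l v.
  have a0 : a != 0 by rewrite mulf_eq0 invr_eq0 negb_or sv.
  have em : m = a *: l + t *: mu by rewrite -et addrC subrK.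
  have av : dot m v = a * dot l v by rewrite /a mulfVK.
  clearbody a; apply: (dvd_scal a0).
  have -> : a%:MP * (G - kappa * lin l) =
      pairing m (tangent z g) + c * (dot m v)%:MP - kappa * lin m.
    have pm b : pairing m b = a%:MP * pairing l b + t%:MP * pairing mu b.
      by rewrite em pairingD !pairingZ.
    have pmu : pairing mu (tangent z g) = kappa * lin mu by rewrite eg pairing_tangentM.
    by rewrite av /G {1 2}/lin !pm pmu mpolyCM /lin; ring.
  by apply: dvdB; [exact: hc | apply: dvd_mull; exact: dvd_refl].
(* Projecting kills [lin l] and turns each [lin m] into the form of its residue, with no loss of
   multiplicity. *)
exists (proj l v q); rewrite big_map -big_filter -/C.
have -> : proj l v G = proj l v (G - kappa * lin l).
  by rewrite rmorphB rmorphM /= proj_self // mulr0 subr0.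
rewrite e rmorphM rmorph_prod; congr (_ * _); apply: eq_bigr => m _.
exact: proj_lin.
Qed.

Lemma newton_interpolation v z g s : {in s, forall m, dot m v != 0} -> pairwise (@indep K) s ->
  {in s &, forall l m, l != m -> dvd (lin (residue v l m)) g} ->
  exists c, {in s, forall m, dvd (lin m) (pairing m (tangent z g) + c * (dot m v)%:MP)}.
Proof.
elim: s => [|l s IH] sv; first by exists 0.
move=> /= /andP [/allP ls ps] hg.
have sv' : {in s, forall m, dot m v != 0} by move=> m ms; apply: sv; rewrite inE ms orbT.
have lv : dot l v != 0 by apply: sv; rewrite mem_head.
have s0 : 0 \notin s.
  apply/negP => /sv'; rewrite /dot big1 ?eqxx // => i _; by rewrite mxE mul0r.
have [|c hc] := IH sv' ps.
  by move=> m1 m2 h1 h2; apply: hg; rewrite inE ?h1 ?h2 orbT.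
pose G := pairing l (tangent z g) + c * (dot l v)%:MP.
have [e he] : dvd (\prod_(m <- [seq residue v l m | m <- s]) lin m) (proj l v G).
  apply: prod_dvd_clusters.
    apply/negP => /mapP [m /ls /andP [_ ml]] /eqP; rewrite eq_sym subr_eq0 => /eqP em.
    by rewrite em scalemx_sub in ml.
  move=> mu /mapP [m ms ->]; apply: cluster_dvd => //.
  apply: hg; rewrite ?mem_head ?inE ?ms ?orbT //.
  have /andP [+ _] := ls _ ms; by apply: contraNneq => ->.
pose h := \prod_(m <- s) lin m.
have eh : proj l v h = \prod_(m <- [seq residue v l m | m <- s]) lin m.
  by rewrite rmorph_prod big_map; apply: eq_bigr => m _; apply: proj_lin.
(* A multiple of [h] does not disturb the earlier lines. With this factor the value at [l] becomes G
   - e h, which is zero modulo [l] because [e] is the quotient of the projections of [G] and [h]. *)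
exists (c - ((dot l v)^-1)%:MP * e * h) => m; rewrite inE => /orP [/eqP ->|ms].
  have -> : pairing l (tangent z g) + (c - ((dot l v)^-1)%:MP * e * h) * (dot l v)%:MP =
    (G - proj l v G) - e * (h - proj l v h).
    have t1 : ((dot l v)^-1)%:MP * (dot l v)%:MP = 1 :> {mpoly K[3]}.
      by rewrite -mpolyCM mulVf.
    rewrite he -eh /G; transitivity (pairing l (tangent z g) + c * (dot l v)%:MP -
      (((dot l v)^-1)%:MP * (dot l v)%:MP) * e * h); first by ring.
    by rewrite t1; ring.
  by apply: dvdB; [|apply: dvd_mull]; apply: dvd_proj.
rewrite mulrBl addrA; apply: dvdB; first exact: hc.
by apply: dvd_mulr; apply: dvd_mull; apply: dvd_prod_mem.
Qed.
End Newton.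

(** * Syzygies of degrees n and m - 1, and their absence in lower degrees *)

Section Bounds.
Local Open Scope ring_scope.
Variable K : fieldType.
Implicit Types (l m v w z : 'rV[K]_3) (F G f g h : {mpoly K[3]}) (s : seq 'rV[K]_3).
Implicit Types (a : 'I_3 -> {mpoly K[3]}).
Local Notation hcomp := (pihomog [measure of mdeg]).

Definition indep_family s : Prop :=
  [/\ uniq s, 0 \notin s & {in s &, forall l m, l != m -> ~~ (l <= m)%MS}].

Lemma indep_family_pairwise s : indep_family s -> pairwise (@indep K) s.
Proof.
case=> us _ hs; elim: s us hs => //= l s IH /andP [ls us] hs.
apply/andP; split; last first.
  by apply: IH => // m1 m2 h1 h2; apply: hs; rewrite inE ?h1 ?h2 orbT.
apply/allP => m ms; have lm : l != m by apply: contraNneq ls => ->.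
by rewrite /indep !hs ?inE ?eqxx ?ms ?orbT // eq_sym.
Qed.

Lemma indep_family_cat s1 s2 :
  indep_family (s1 ++ s2) -> indep_family s1 /\ indep_family s2.
Proof.
case; rewrite cat_uniq mem_cat negb_or => /and3P [u1 _ u2] /andP [s10 s20] h.
by split; split=> // l m ls ms; apply: h; rewrite mem_cat ?ls ?ms ?orbT.
Qed.

Lemma syzygyP f k : jacobian_syzygy f k <->
  exists a, [/\ forall i, a i \is k.-homog, exists i, a i != 0 & der a f = 0].
Proof.
split=> [[a [b [c [[ha hb hc] nz e]]]]|[a [ha [i ai] e]]].
  pose u (i : 'I_3) := if i == o0 then a else if i == o1 then b else c.
  have [u0 u1 u2] : [/\ u o0 = a, u o1 = b & u o2 = c].
    by split; rewrite /u -!val_eqE /= !inordK.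
  exists u; split.
  - by move=> i; case: (ord3P i) => ->; rewrite ?u0 ?u1 ?u2.
  - have [a0|a0] := eqVneq a 0; last by exists o0; rewrite u0.
    have [b0|b0] := eqVneq b 0; last by exists o1; rewrite u1.
    have [c0|c0] := eqVneq c 0; last by exists o2; rewrite u2.
    by case: nz.
  - by rewrite /der sum_I3 u0 u1 u2.
exists (a o0), (a o1), (a o2); split; [by split| |by rewrite -[RHS]e /der sum_I3].
by case=> h0 h1 h2; case: (ord3P i) ai => ->; rewrite ?h0 ?h1 ?h2 eqxx.
Qed.

(** If [a] multiplies f by [q], subtracting q/d times the Euler field, which multiplies f by d,
    leaves a field killing f. The last hypothesis makes the difference nonzero. *)
Lemma euler_syzygy s a q k : (size s)%:R != 0 :> K ->
  (forall i, a i \is k.-homog) -> (forall i, q * 'X_i \is k.-homog) ->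
  der a (\prod_(l <- s) lin l) = q * \prod_(l <- s) lin l ->
  (exists i, a i != ((size s)%:R^-1)%:MP * q * 'X_i) ->
  jacobian_syzygy (\prod_(l <- s) lin l) k.
Proof.
move=> d0 ha hq e [i hi]; set d : K := (size s)%:R in d0 hi.
apply/syzygyP; exists (fun i => 1 * a i + (- (d^-1)%:MP * q) * 'X_i); split.
- move=> j; rewrite mul1r; apply: dhomogD => //.
  by rewrite mulNr mulNr -mulrA mul_mpolyC rpredN; apply: dhomogZ.
- by exists i; rewrite mul1r mulNr mulNr subr_eq0.
rewrite der_comb euler_prod e mul1r -mpolyC_nat -/d.
transitivity ((1 - (d^-1)%:MP * d%:MP) * (q * \prod_(l <- s) lin l)); first by ring.
by rewrite -mpolyCM mulVf // subrr mul0r.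
Qed.

Lemma homogMX F k i : F \is k.-homog -> F * 'X_i \is k.+1.-homog.
Proof.
move=> hF; have hX : ('X_i : {mpoly K[3]}) \is 1.-homog by rewrite dhomogX /= mdeg1.
by have := dhomogM hF hX; rewrite addn1.
Qed.

Lemma syzygy_nonmodular v s1 s2 : (size (s1 ++ s2))%:R != 0 :> K -> v != 0 ->
  s1 != [::] -> 0 \notin s1 -> 0 \notin s2 ->
  {in s1, forall l, dot l v = 0} ->
  jacobian_syzygy (\prod_(l <- s1 ++ s2) lin l) (size s2).
Proof.
move=> d0 v0 s1n s10 s20 hv; set g := \prod_(l <- s1) lin l; set h := \prod_(l <- s2) lin l.
have h0 : h != 0 by exact: prod_lin_neq0.
pose q := der (const_field v) h; pose a i := h * const_field v i.
have hh : h \is (size s2).-homog by exact: prod_lin_homog.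
have ea F : der a F = h * der (const_field v) F.
  by rewrite /der mulr_sumr; apply: eq_bigr => i _; rewrite mulrA.
have gv : der (const_field v) g = 0.
  rewrite (der_prod (q := fun=> 0)) => [|l ls]; first by rewrite big1 // mul0r.
  by rewrite der_lin pairing_const hv // mul0r.
apply: (@euler_syzygy _ a q) => //.
- by move=> i; rewrite /a mulrC mul_mpolyC; apply: dhomogZ.
- move=> i; rewrite /q /der mulr_suml; apply: rpred_sum => j _.
  rewrite /const_field -mulrA mul_mpolyC; apply: dhomogZ.
  case: (size s2) hh => [|k] hk; last first.
    by apply: homogMX; apply: mderiv_homog hk.
  (* With [s2] empty, [h] is a constant. *)
  have -> : h^`M(j) = 0; last by rewrite mul0r rpred0.
  rewrite /mderiv big_seq big1 // => m /(dhomog_mf hk) /= /eqP.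
  by rewrite mdeg_eq0 => /eqP ->; rewrite mnm0E mul0r scale0r.
- by rewrite big_cat /= -/g -/h ea derM gv /q; ring.
(* Were h D_v a multiple of the Euler field, evaluating at a line through <v> would make that
   multiple zero, hence h v = 0. *)
apply/existsP; apply: contraT; rewrite negb_exists => /forallP ha.
set d := (size (s1 ++ s2))%:R in d0 ha.
have {ha} ha i : a i = (d^-1)%:MP * q * 'X_i by have := ha i; rewrite negbK => /eqP.
case: s1 s1n s10 hv {g gv} @d d0 ha => // l s1 _ s10 hv d d0 ha.
have : pairing l (fun i => h * const_field v i + 0 * const_field v i) = (d^-1)%:MP * q * lin l.
  transitivity (pairing l (fun i => (d^-1)%:MP * q * 'X_i + 0 * 'X_i)).
    by apply: eq_bigr => i _; rewrite -ha !mul0r !addr0.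
  by rewrite pairing_comb mul0r addr0.
rewrite pairing_comb pairing_const hv ?mem_head // mpolyC0 !mulr0 addr0.
move/esym/eqP; rewrite mulf_eq0 lin_eq0.
have -> : (l == 0) = false by move: s10; rewrite inE negb_or eq_sym => /andP [/negbTE ->].
rewrite orbF => /eqP dq; case/eqP: v0; apply/rowP => i; rewrite mxE.
have /eqP := ha i; rewrite dq mul0r mulf_eq0 (negbTE h0) /= /const_field mpolyC_eq0.
by move/eqP.
Qed.

Lemma der_prod_homog a s k :
  {in s, forall l, exists2 q, q \is k.-homog & pairing l a = q * lin l} ->
  exists2 q, q \is k.-homog & der a (\prod_(l <- s) lin l) = q * \prod_(l <- s) lin l.
Proof.
elim: s => [|l s IH] hs; first by exists 0; rewrite ?rpred0 // big_nil der1 mul0r.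
have [q hq e] := hs l (mem_head _ _).
have [m ms|q' hq' e'] := IH; first by apply: hs; rewrite inE ms orbT.
exists (q + q'); first exact: rpredD.
by rewrite big_cons derM der_lin e e'; ring.
Qed.

Lemma tangent_homog z g k i : g \is k.+1.-homog -> tangent z g i \is k.-homog.
Proof.
move=> hg; have [e0 e1 e2] := cross_prodE (const_field z) (grad g).
by case: (ord3P i) => ->; rewrite /tangent ?e0 ?e1 ?e2 /const_field /grad !mul_mpolyC;
  apply: rpredB; apply: dhomogZ; apply: mderiv_homog hg.
Qed.

Lemma pairing_homog l a k : (forall i, a i \is k.-homog) -> pairing l a \is k.-homog.
Proof. by move=> ha; apply: rpred_sum => i _; rewrite mul_mpolyC dhomogZ. Qed.

(** The interpolated theta kills [g] and multiplies each line of [h] by a polynomial, so it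
    multiplies f = g h by one and [euler_syzygy] applies. *)
Lemma syzygy_modular v s1 s2 z : (forall n, n.+1%:R != 0 :> K) ->
  z \in s2 -> (2 <= size s1)%N ->
  indep_family s1 -> indep_family s2 ->
  {in s1, forall l, dot l v = 0} -> {in s2, forall l, dot l v != 0} ->
  {in s2 &, forall l m, l != m -> dvd (lin (residue v l m)) (\prod_(l <- s1) lin l)} ->
  jacobian_syzygy (\prod_(l <- s1 ++ s2) lin l) (size s1).-1.
Proof.
move=> char0 zs2; case es1 : (size s1) => [|[|k]] // _ hs1 hs2 v1 v2 hmod /=.
set g := \prod_(l <- s1) lin l in hmod; set h := \prod_(l <- s2) lin l.
have hg : g \is k.+2.-homog by rewrite -es1; apply: prod_lin_homog.
have g0 : g != 0 by case: hs1 => _ *; apply: prod_lin_neq0.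
have [c0 hc0] := newton_interpolation z v2 (indep_family_pairwise hs2) hmod.
(* The interpolating [c0] may be inhomogeneous. Its component in the degree of T still works, as the
   conditions are divisibilities by homogeneous forms. *)
pose c := hcomp k.+1 c0; have hc : c \is k.+1.-homog by apply: pihomogP.
pose a i := 1 * tangent z g i + c * const_field v i.
have pa l : pairing l a = pairing l (tangent z g) + c * (dot l v)%:MP.
  by rewrite pairing_comb pairing_const mul1r.
have ha i : a i \is k.+1.-homog.
  rewrite /a mul1r mulrC mul_mpolyC; apply: rpredD; first exact: tangent_homog.
  exact: dhomogZ.
have hq2 : {in s2, forall l, exists2 q, q \is k.-homog & pairing l a = q * lin l}.
  move=> l ls; have [Q eQ] := hc0 l ls; exists (hcomp k Q); first exact: pihomogP.
  have := congr1 (hcomp k.+1) eQ; rewrite (hcompM _ _ (lin_homog l)) /= subn1 /= => <-.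
  rewrite raddfD /= pihomog_dE; last by apply: pairing_homog => i; apply: tangent_homog.
  by rewrite pa /c [c0 * _]mulrC [hcomp _ _ * _]mulrC !mul_mpolyC linearZ.
have [q hq] := der_prod_homog hq2; rewrite -/h => eh.
have gv : der (const_field v) g = 0.
  rewrite (der_prod (q := fun=> 0)) => [|l ls]; first by rewrite big1 // mul0r.
  by rewrite der_lin pairing_const v1 // mul0r.
have eg : der a g = 0 by rewrite der_comb der_tangent gv !mulr0 addr0.
set d : K := (size (s1 ++ s2))%:R.
have d0 : d != 0 by rewrite /d size_cat es1 addSn.
apply: (@euler_syzygy _ a q) => //.
- by move=> i; apply: homogMX.
- rewrite big_cat /= -/g -/h derM eg eh; ring.
rewrite -/d; apply/existsP; apply: contraT; rewrite negb_exists => /forallP na.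
pose t := (d^-1)%:MP * q.
have {na} na i : a i = t * 'X_i by have := na i; rewrite negbK => /eqP.
have eX F : der a F = t * der (fun i => 'X_i) F.
  by rewrite /der mulr_sumr; apply: eq_bigr => i _; rewrite na mulrA.
(* theta kills [g], whereas the Euler field multiplies it by m, nonzero in [K]. *)
have t0 : t = 0.
  have /eqP := eX g; rewrite eg euler_prod -/g es1 eq_sym !mulf_eq0 (negbTE g0) orbF.
  rewrite -mpolyC_nat !mpolyC_eq0 (negbTE (char0 _)) orbF invr_eq0 (negbTE d0) /=.
  by move/eqP => q0; rewrite /t q0 mulr0.
have a0 i : a i = 0 by rewrite na t0 mul0r.
(* T vanishes on [z], so theta(z) = c z(v). *)
have c00 : c = 0.
  have : pairing z a = 0 by rewrite /pairing big1 // => i _; rewrite a0 mulr0.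
  rewrite pa pairing_tangent_self add0r => /eqP; rewrite mulf_eq0 mpolyC_eq0 (negbTE (v2 z zs2)).
  by rewrite orbF => /eqP.
(* Now T = 0, so [g] has zero gradient, against Euler's identity. *)
have dg : forall i, g^`M(i) = 0.
  apply: (tangent_eq0 (v2 z zs2) gv) => i.
  by have := a0 i; rewrite /a c00 mul0r addr0 mul1r.
have : der (fun i => 'X_i) g = 0 by rewrite /der big1 // => i _; rewrite dg mulr0.
rewrite euler_prod -/g es1 => /eqP; rewrite mulf_eq0 (negbTE g0) orbF.
by rewrite -mpolyC_nat mpolyC_eq0 (negbTE (char0 _)).
Qed.

(** By the Leibniz rule [lin l] divides [pairing l a] times the product of the other lines, to which
    it is prime. *)
Lemma der_eq0_dvd s a : indep_family s -> der a (\prod_(l <- s) lin l) = 0 ->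
  {in s, forall l, dvd (lin l) (pairing l a)}.
Proof.
case=> us s0 hs e l ls.
have l0 : l != 0 by apply: contraNneq s0 => <-.
apply: (@dvd_lin_prodl _ _ (rem l s)) => // [m|].
  by rewrite mem_rem_uniq // inE => /andP [ml ms]; apply: hs.
move: e; rewrite (big_rem l ls) /= derM der_lin => /eqP.
rewrite addr_eq0 => /eqP ->; rewrite -mulrN mulrC; apply: dvd_mull; exact: dvd_refl.
Qed.

(** Evaluating a vanishing combination at [v] removes [z], and [x], [y] are independent; so the
    three covectors form a basis. *)
Lemma basis_comb v x y z l : dot x v = 0 -> dot y v = 0 -> dot z v != 0 ->
  x != 0 -> ~~ (y <= x)%MS ->
  exists b c e, l = b *: x + c *: y + e *: z.
Proof.
move=> xv yv zv x0 yx.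
pose B : 'M[K]_3 := col_mx x (col_mx y z).
have comb (u : 'rV[K]_3) : u *m B = u 0 o0 *: x + u 0 o1 *: y + u 0 o2 *: z.
  apply/rowP => j; rewrite !mxE sum_I3.
  have r (M : 'M[K]_(1 + (1 + 1), 3)) : [/\ M o0 = M (lshift _ 0),
     M o1 = M (rshift 1 (lshift 1 0)) & M o2 = M (rshift 1 (rshift 1 0))].
    by split; congr (M _); apply: val_inj; rewrite /= inordK.
  rewrite /B; have [-> -> ->] := r (col_mx x (col_mx y z)).
  by rewrite !(col_mxEu, col_mxEd).
have : row_free B.
  apply: inj_row_free => u.
  rewrite comb => e.
  have u2 : u 0 o2 = 0.
    have : dot (u 0 o0 *: x + u 0 o1 *: y + u 0 o2 *: z) v = 0.
      by rewrite e /dot big1 // => i _; rewrite mxE mul0r.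
    rewrite !dotD !dotZ xv yv !mulr0 !add0r => /eqP.
    by rewrite mulf_eq0 (negbTE zv) orbF => /eqP.
  have u1 : u 0 o1 = 0.
    apply: contraNeq yx => u1; apply/sub_rVP; exists (- (u 0 o1)^-1 * u 0 o0).
    have : u 0 o1 *: y = - (u 0 o0 *: x).
      by apply/eqP; rewrite -addr_eq0 addrC; move: e; rewrite u2 scale0r addr0 => ->.
    move/(congr1 (fun w => (u 0 o1)^-1 *: w)); rewrite scalerA mulVf // scale1r => ->.
    by rewrite scalerN scalerA mulNr scaleNr.
  have u0 : u 0 o0 = 0.
    move: e => /eqP; rewrite u2 u1 !scale0r !addr0 scaler_eq0 (negbTE x0) orbF.
    by move/eqP.
  by apply/rowP => i; rewrite mxE; case: (ord3P i) => ->.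
rewrite row_free_unit => uB.
pose u := l *m invmx B; exists (u 0 o0), (u 0 o1), (u 0 o2).
by rewrite -comb mulmxKV.
Qed.

Lemma syzygy_eq0 v s1 s2 k a : (size (s1 ++ s2))%:R != 0 :> K -> (0 < k)%N ->
  (k.+1 < size s1)%N -> (k < size s2)%N ->
  indep_family (s1 ++ s2) ->
  {in s1, forall l, dot l v = 0} -> {in s2, forall l, dot l v != 0} ->
  (forall i, a i \is k.-homog) -> der a (\prod_(l <- s1 ++ s2) lin l) = 0 ->
  forall i, a i = 0.
Proof.
move=> d0 k0 k1 k2 hs v1 v2 ha e.
have hdvd := der_eq0_dvd hs e.
have [hs1 hs2] := indep_family_cat hs.
have [x [y [xs ys xy x0]]] : exists x y, [/\ x \in s1, y \in s1, ~~ (y <= x)%MS & x != 0].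
  case: s1 {hs v1 e hdvd d0} k1 hs1 => [|x [|y s1]] //= _ [/andP [xn _] s10 h].
  exists x, y; split; rewrite ?inE ?eqxx ?orbT //.
    by apply: h; rewrite ?inE ?eqxx ?orbT //; apply: contraNneq xn => ->; rewrite mem_head.
  by apply: contraNneq s10 => <-; rewrite mem_head.
have [z zs] : exists z, z \in s2.
  by case: s2 k2 {hs v2 e hdvd hs2 d0} => // z s2 _; exists z; rewrite mem_head.
have comb l := basis_comb l (v1 x xs) (v1 y ys) (v2 z zs) x0 xy.
have d1 l : l \in s1 -> dvd (lin l) (pairing l a) by move=> ls; apply: hdvd; rewrite mem_cat ls.
have d2 l : l \in s2 -> dvd (lin l) (pairing l a).
  by move=> ls; apply: hdvd; rewrite mem_cat ls orbT.
(* Both sides have degree k + 1, below [size s1], so it suffices that each line l = b x + c y of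
   [s1] divides the difference. Multiplied by b or c, whichever is nonzero, the difference is a
   combination of a(l) and l. *)
have Q0 : lin y * pairing x a = lin x * pairing y a.
  apply/eqP; rewrite -subr_eq0; apply/eqP.
  apply: (@homog_dvd_eq0 K (1 + k) (size s1) _ (\prod_(l <- s1) lin l)) => //.
  - by apply: rpredB; apply: dhomogM; rewrite ?lin_homog // pairing_homog.
  - exact: prod_lin_homog.
  apply: prod_dvd_indep; [by case: hs1|exact: indep_family_pairwise|move=> l ls].
  have [b [c [t el]]] := comb l.
  have t0 : t = 0.
    have /eqP := v1 l ls; rewrite el !dotD !dotZ (v1 x xs) (v1 y ys) !mulr0 !add0r.
    by rewrite mulf_eq0 (negbTE (v2 z zs)) orbF => /eqP.
  have pl u : pairing l u = b%:MP * pairing x u + c%:MP * pairing y u.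
    by rewrite el t0 scale0r addr0 pairingD !pairingZ.
  have [b0|b0] := eqVneq b 0; last first.
    apply: (dvd_scal b0).
    have -> : b%:MP * (lin y * pairing x a - lin x * pairing y a) =
      lin y * pairing l a - pairing y a * lin l by rewrite [lin l]/lin !pl /lin; ring.
    apply: dvdB; apply: dvd_mull; [exact: d1|exact: dvd_refl].
  have c0 : c != 0.
    case: hs1 => _ s10 _; apply: contraNneq s10 => c0.
    by have := el; rewrite b0 c0 t0 !scale0r !addr0 => <-.
  apply: (dvd_scal c0).
  have -> : c%:MP * (lin y * pairing x a - lin x * pairing y a) =
    pairing x a * lin l - lin x * pairing l a by rewrite [lin l]/lin !pl /lin; ring.
  apply: dvdB; apply: dvd_mull; [exact: dvd_refl|exact: d1].
have [w ew] := d1 x xs.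
have ewy : pairing y a = w * lin y.
  by apply: (@mulfI _ (lin x)); [rewrite lin_eq0|rewrite -Q0 ew; ring].
have hw : w \is (k.-1).-homog.
  apply: (homog_quotient (i := k.-1) (j := 1) _ (lin_homog x) _ ew).
    by rewrite addn1 prednK // pairing_homog.
  by rewrite lin_eq0.
(* Subtracting w E yields a field that vanishes on [x] and [y], hence c D_v up to the scalar
   z(v). *)
pose a' i := 1 * a i + (- w) * 'X_i.
have pa' l : pairing l a' = pairing l a - w * lin l by rewrite pairing_comb mul1r mulNr.
pose c := pairing z a'.
have cl l : exists t, pairing l a' = t%:MP * c /\ dot l v = t * dot z v.
  have [b [b' [t ->]]] := comb l; exists t; split; last first.
    by rewrite !dotD !dotZ (v1 x xs) (v1 y ys) !mulr0 !add0r.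
  rewrite !pairingD !pairingZ -/c.
  have -> : pairing x a' = 0 by rewrite pa' ew subrr.
  have -> : pairing y a' = 0 by rewrite pa' ewy subrr.
  by rewrite !mulr0 !add0r.
have c0 : c = 0.
  apply: (@homog_dvd_eq0 K k (size s2) _ (\prod_(l <- s2) lin l)) => //.
  - rewrite /c pa'; apply: rpredB; first exact: pairing_homog.
    by have := dhomogM hw (lin_homog z); rewrite addn1 prednK.
  - exact: prod_lin_homog.
  apply: prod_dvd_indep; [by case: hs2|exact: indep_family_pairwise|move=> l ls].
  have [t [et vt]] := cl l.
  have t0 : t != 0 by apply: contraNneq (v2 l ls) => t0; rewrite vt t0 mul0r.
  apply: (dvd_scal t0); rewrite -et pa'; apply: dvdB; first exact: d2.
  by apply: dvd_mull; apply: dvd_refl.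
have a'0 i : a' i = 0.
  by have [t [et _]] := cl (delta_mx 0 i); rewrite -pairing_delta et c0 mulr0.
have ax i : a i = w * 'X_i.
  by apply/eqP; have := a'0 i; rewrite /a' mul1r mulNr => /eqP; rewrite subr_eq0.
(* Now a = w E multiplies f by d w, yet it kills f. *)
have w0 : w = 0.
  have ed : der a (\prod_(l <- s1 ++ s2) lin l) =
      w * der (fun i => 'X_i) (\prod_(l <- s1 ++ s2) lin l).
    by rewrite /der mulr_sumr; apply: eq_bigr => i _; rewrite ax mulrA.
  move: ed; rewrite e euler_prod => /esym/eqP; rewrite !mulf_eq0.
  have f0 : \prod_(l <- s1 ++ s2) lin l != 0 by case: hs => _ *; apply: prod_lin_neq0.
  by rewrite (negbTE f0) orbF -mpolyC_nat mpolyC_eq0 (negbTE d0) orbF => /eqP.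
by move=> i; rewrite ax w0 mul0r.
Qed.
End Bounds.

(** * From lines as subspaces to covectors, and the formula for r *)

Section Geometry.
Local Open Scope ring_scope.
Variable K : fieldType.
Implicit Types (l m u v w : 'rV[K]_3) (A : seq {vspace 'rV[K]_3}).

Lemma dotDr l u v : dot l (u + v) = dot l u + dot l v.
Proof. by rewrite dotC dotD !(dotC _ l). Qed.

Lemma dotZr l t u : dot l (t *: u) = t * dot l u.
Proof. by rewrite dotC dotZ (dotC u). Qed.

(** Each basis vector is moved into the kernel of [l] along [w]; there [m] vanishes too, which
    yields its coordinates. *)
Lemma kernel_sub l m : l != 0 -> (forall u, dot l u = 0 -> dot m u = 0) -> (m <= l)%MS.
Proof.
move=> /dot_neq0 [w lw] h; apply/sub_rVP; exists (dot m w / dot l w).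
apply/rowP => i; rewrite mxE -!dot_delta; set u := delta_mx 0 i.
have : dot m (u + (- (dot l u / dot l w)) *: w) = 0.
  by apply: h; rewrite dotDr dotZr mulNr divfK ?subrr.
rewrite dotDr dotZr => /eqP; rewrite addr_eq0 => /eqP ->.
by rewrite mulNr opprK; ring.
Qed.

Definition covectors_of A (c : {vspace 'rV[K]_3} -> 'rV[K]_3) : Prop :=
  forall H, H \in A -> forall u, (u \in H) = (dot (c H) u == 0).

Section Covectors.
Variables (A : seq {vspace 'rV[K]_3}) (c : {vspace 'rV[K]_3} -> 'rV[K]_3).
Hypotheses (hA : line_arrangement A) (hc : covectors_of A c).

Lemma dim_line H : H \in A -> \dim H = 2%N.
Proof. by case/andP: hA => _ /allP h /h /eqP. Qed.

Lemma covector_neq0 H : H \in A -> c H != 0.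
Proof.
move=> HA; apply/eqP => c0; have := dim_line HA.
have -> : H = fullv.
  by apply/vspaceP => u; rewrite (hc HA) memvf c0 /dot big1 ?eqxx // => i _;
    rewrite mxE mul0r.
by rewrite dimvf /dim /= mul1n.
Qed.

Lemma covector_indep H H' : H \in A -> H' \in A -> (c H <= c H')%MS -> H = H'.
Proof.
move=> HA HA' /sub_rVP [t e].
have t0 : t != 0.
  by apply: contraNneq (covector_neq0 HA) => t0; rewrite e t0 scale0r.
by apply/vspaceP => u; rewrite (hc HA) (hc HA') e dotZ mulf_eq0 (negbTE t0).
Qed.

Lemma covectors_indep_family : indep_family [seq c H | H <- A].
Proof.
case/andP: (hA) => uA _; split.
- rewrite map_inj_in_uniq // => H H' HA HA' e.
  by apply: covector_indep => //; rewrite e submx_refl.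
- by apply/negP => /mapP [H /covector_neq0 + e]; rewrite -e eqxx.
move=> _ _ /mapP [H HA ->] /mapP [H' HA' ->]; apply: contraNN => h.
by rewrite (covector_indep HA HA' h).
Qed.

Lemma multiplicity_ge2 H H' (q : {vspace 'rV[K]_3}) : H \in A -> H' \in A -> H != H' ->
  (q <= H)%VS -> (q <= H')%VS -> (2 <= multiplicity A q)%N.
Proof.
move=> HA HA' ne qH qH'; rewrite /multiplicity -size_filter.
have := @uniq_leq_size _ [:: H; H'] [seq X <- A | (q <= X)%VS]; apply.
  by rewrite /= inE ne.
by move=> X; rewrite !inE mem_filter => /orP [] /eqP ->; rewrite ?qH ?qH' ?HA ?HA'.
Qed.

Lemma line_cap_point H H' : H \in A -> H' \in A -> H != H' -> \dim (H :&: H') = 1%N.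
Proof.
move=> HA HA' ne; have := dimv_sum_cap H H'; rewrite (dim_line HA) (dim_line HA').
have : (\dim (H + H')%VS <= 3)%N.
  by apply: leq_trans (rank_leq_col _) _; rewrite /dim /= mul1n.
have : (\dim (H :&: H')%VS < 2)%N.
  rewrite ltnNge; apply: contraNN ne => d2.
  have e1 : (H :&: H')%VS = H.
    by apply/eqP; rewrite eqEdim capvSl (dim_line HA).
  have e2 : (H :&: H')%VS = H'.
    by apply/eqP; rewrite eqEdim capvSr (dim_line HA').
  by rewrite -e1 e2.
lia.
Qed.

(** By modularity the line joining <v> to the intersection of [H] and [H'] is in [A]. The residue
    vanishes on both points, so it is proportional to the covector of that line. *)
Lemma modular_residue v H H' : v != 0 -> modular_point A <[v]>%VS ->
  H \in A -> H' \in A -> H != H' -> v \notin H ->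
  exists H0, [/\ H0 \in A, v \in H0 & dvd (lin (residue v (c H) (c H'))) (lin (c H0))].
Proof.
move=> v0 [_ hm] HA HA' ne vH; pose q := (H :&: H')%VS.
have vc : dot (c H) v != 0 by rewrite -(hc HA).
have qA : (<[v]> + q)%VS \in A.
  apply: hm.
    rewrite /intersection_point /is_point line_cap_point //=.
    by apply: multiplicity_ge2 HA HA' ne _ _; rewrite ?capvSl ?capvSr.
  by move=> e; move: vH; rewrite memvE -e capvSl.
exists (<[v]> + q)%VS; split=> //; first by rewrite memvE addvSl.
set r := residue v (c H) (c H').
have r0 : r != 0.
  rewrite subr_eq0; apply/eqP => e; case/eqP: ne; apply/esym.
  by apply: covector_indep; rewrite // e scalemx_sub.
have rv : dot r v = 0 by rewrite dotB dotZ divfK ?subrr.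
have : (r <= c (<[v]> + q)%VS)%MS.
  apply: kernel_sub; first exact: covector_neq0.
  move=> u /eqP; rewrite -(hc qA) => /memv_addP [u1 /vlineP [t ->] [u2]].
  rewrite memv_cap (hc HA) (hc HA') => /andP [/eqP h1 /eqP h2] ->.
  by rewrite dotDr dotZr rv mulr0 add0r dotB dotZ h1 h2 mulr0 subr0.
move/(row_sub_sym r0) => /sub_rVP [t ->].
by exists t%:MP; rewrite /lin pairingZ.
Qed.

End Covectors.

Lemma mdr_modular_point A f r v : (forall n, n.+1%:R != 0 :> K) ->
  line_arrangement A -> defining_polynomial A f -> is_mdr f r -> (1 <= r)%N ->
  v != 0 -> modular_point A <[v]>%VS ->
  r = minn (multiplicity A <[v]>%VS - 1) (size A - multiplicity A <[v]>%VS).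
Proof.
move=> char0 hA [lf [hl ef]] [hr hmin] r1 v0 hp.
pose c H := coefs (lf H).
have elf H : H \in A -> lf H = lin (c H) by move=> /hl [h _]; apply: lin_coefs.
have hc : covectors_of A c.
  move=> H HA u; have [_ /(_ u) h] := hl H HA.
  by rewrite -meval_lin -elf //; apply/idP/eqP => /h.
pose A1 := [seq H : {vspace 'rV[K]_3} <- A | v \in H].
pose A2 := [seq H : {vspace 'rV[K]_3} <- A | v \notin H].
pose s1 := map c A1; pose s2 := map c A2.
have pA : perm_eq (A1 ++ A2) A by rewrite perm_filterC.
have pc : perm_eq (s1 ++ s2) (map c A) by rewrite -map_cat perm_map.
have efs : f = \prod_(l <- s1 ++ s2) lin l.
  rewrite (perm_big _ pc) big_map ef big_seq [RHS]big_seq.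
  by apply: eq_bigr => H /elf.
have sz1 : size s1 = multiplicity A <[v]>%VS.
  by rewrite size_map size_filter; apply: eq_count => H; rewrite /= memvE.
have szA : size (s1 ++ s2) = size A by rewrite (perm_size pc) size_map.
have sz2 : size s2 = (size A - multiplicity A <[v]>%VS)%N.
  by rewrite -szA size_cat sz1 addKn.
have hs : indep_family (s1 ++ s2).
  have [ua a0 hi] := covectors_indep_family hA hc.
  split; rewrite ?(perm_uniq pc) ?(perm_mem pc) //.
  by move=> l m; rewrite !(perm_mem pc); apply: hi.
have v1 : {in s1, forall l, dot l v = 0}.
  by move=> _ /mapP [H + ->]; rewrite mem_filter => /andP [+ HA]; rewrite (hc H HA) => /eqP.
have v2 : {in s2, forall l, dot l v != 0}.
  by move=> _ /mapP [H + ->]; rewrite mem_filter => /andP [+ HA]; rewrite (hc H HA).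
have m2 : (2 <= size s1)%N by rewrite sz1; case: hp => /andP [].
have d0 : (size (s1 ++ s2))%:R != 0 :> K.
  by rewrite size_cat; case: (size s1) m2 => // k _; rewrite addSn.
have [hs1 hs2] := indep_family_cat hs.
have le_n : (r <= size s2)%N.
  apply: hmin; rewrite efs; apply: (syzygy_nonmodular (v := v)) => //.
  - by case: (s1) m2.
  - by case: hs1.
  - by case: hs2.
(* As 1 <= r <= n, some line misses the point; its covector serves as [z]. *)
have [z zs2] : exists z, z \in s2.
  by case: (s2) (leq_trans r1 le_n) => // z s _; exists z; rewrite mem_head.
have le_m : (r <= (size s1).-1)%N.
  apply: hmin; rewrite efs; apply: (syzygy_modular (v := v) (z := z)) => //.
  move=> _ _ /mapP [H + ->] /mapP [H' + ->]; rewrite !mem_filter => /andP [vH HA] /andP [_ HA'] ne.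
  have HH' : H != H' by apply: contraNneq ne => ->.
  have [H0 [H0A vH0 h]] := modular_residue hA hc v0 hp HA HA' HH' vH.
  apply: dvd_trans h _; apply: dvd_prod_mem; apply: map_f.
  by rewrite mem_filter vH0.
(* Below both bounds, [syzygy_eq0] would annihilate the syzygy of degree [r]. *)
have ge : ~~ (r < minn (size s1).-1 (size s2))%N.
  rewrite leq_min; apply/negP => /andP [rm rn].
  move: hr; rewrite efs => /syzygyP [a [ha [i ai] e]].
  have := @syzygy_eq0 K v s1 s2 r a d0 r1 _ rn hs v1 v2 ha e i.
  by rewrite -ltn_predRL => /(_ rm)/eqP; rewrite (negbTE ai).
by move: ge le_n le_m; rewrite -sz2 -sz1; lia.
Qed.

End Geometry.

Theorem proposition3p2 (R : realType) (d : nat)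
    (A : seq {vspace 'rV[complex R]_3}) (f : {mpoly (complex R)[3]}) (r : nat)
    (hA : line_arrangement A) (hd : size A = d)
    (hf : defining_polynomial A f)
    (hss : supersolvable A)
    (hr : is_mdr f r) (hr1 : (1 <= r)%N)
    (p : {vspace 'rV[complex R]_3}) (hp : modular_point A p) :
  (multiplicity A p = (r + 1)%N \/ multiplicity A p = (d - r)%N) /\
  r = minn (multiplicity A p - 1) (d - multiplicity A p).
Proof.
have char0 n : (n.+1%:R != 0 :> complex R)%R by rewrite Num.Theory.pnatr_eq0.
have [hpt hmod] := hp; have /andP [/eqP dp m2] := hpt.
have [v v0 ep] : exists2 v, v != 0%R & p = <[v]>%VS.
  have p0 : p != 0%VS by rewrite -dimv_eq0 dp.
  exists (vpick p); first by rewrite vpick0.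
  apply/esym/eqP; rewrite eqEdim -memvE memv_pick dp dim_vline vpick0 p0 //.
have := mdr_modular_point char0 hA hf hr hr1 v0.
rewrite -ep hd => /(_ hp) er; split; last exact: er.
(* The two alternatives are the two ways of attaining the minimum; this bound lets the truncated
   subtractions be inverted. *)
have : multiplicity A p <= d by rewrite -hd count_size.
by move: er; rewrite /minn; case: ltnP; lia.
Qed.
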